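(* The set $\mathrm{Z}(C)$ contains all classical symmetries $\mathcal{X}'=\sum_{i=1}^p\xi_i'\partial_{x_i}+\eta'\partial_u$ with $\xi_1'\neq0$ of the PDE $\mathrm{F}[u]=0$, through the transformations $\xi_i'=\xi_1'\xi_i$ $(i=2,\ldots,p)$, $\eta'=\xi_1'\eta$. More precisely, $\mathrm{Z}(C')\subset\mathrm{Z}(C)$ in the sense of equivalence of operators: whenever $\Lambda'=(\xi_1',\ldots,\xi_p',\eta')\in\mathrm{Z}(C')$ with $\xi_1'\ne0$, the corresponding $\Lambda=(\xi_2,\ldots,\xi_p,\eta)=(\xi_2'/\xi_1',\ldots,\xi_p'/\xi_1',\eta'/\xi_1')$ (together with $\xi_1'$) is a zero of $C\subset\mathcal{K}_{\mathbf{z}}[\Lambda,\xi_1']$.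
   Context: **PDE and symmetries.** Let $\mathrm{F}[u]=\mathrm{F}(\mathbf{x},\partial^k u)=0$ be a scalar $k$th order PDE with independent variables $\mathbf{x}=(x_1,\ldots,x_p)$ and one dependent variable $u$, where $\partial^k u$ denotes all derivatives of $u$ of order $\le k$ and $\mathrm{F}$ is a polynomial in its arguments. Put $\mathbf{z}=(x_1,\ldots,x_p,u)$. A classical symmetry is an operator $\mathcal{X}'=\sum_{i=1}^p\xi_i'\partial_{x_i}+\eta'\partial_u$, with coefficients functions of $\mathbf{z}$, whose prolongation satisfies $\mathrm{Pr}\mathcal{X}'(\mathrm{F})=0$ whenever $\mathrm{F}=0$. This condition is equivalent to an overdetermined system $\mathcal{D}'=0$ of homogeneous linear PDEs (the determining equations) for $\Lambda'=(\xi_1',\ldots,\xi_p',\eta')$. Two operators $\mathcal{X}',\mathcal{X}$ are equivalent if $\mathcal{X}'=\lambda(\mathbf{z})\mathcal{X}$ for a nonzero function $\lambda$. A $\Lambda=(\xi_2,\ldots,\xi_p,\eta)$ is identified with the operator $\partial_{x_1}+\sum_{i=2}^p\xi_i\partial_{x_i}+\eta\partial_u$. **Differential polynomials.** $\mathcal{K}_{\mathbf{z}}$ is a field of characteristic zero of differential functions of $\mathbf{z}$, and $\mathcal{K}_{\mathbf{z}}[\zeta]$ is the ring of differential polynomials over it in the indeterminates $\zeta$ (differentiation with respect to the components of $\mathbf{z}$). $\mathcal{D}'\subset\mathcal{K}_{\mathbf{z}}[\Lambda']$ is the set of left-hand sides of the classical determining equations. $\mathrm{Z}(\cdot)$ denotes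 the set of zeros of a differential polynomial system over some extension of $\mathcal{K}_{\mathbf{z}}$, i.e. the solution set of the corresponding system of equations. Given a rank (ordering) $\prec$ of differential polynomials, the initial of a differential polynomial is the coefficient of (the highest power of) its leading derivative, and its separant is its partial derivative with respect to the leading derivative. A differential ascending chain is a finite set $\mathcal{A}_1\prec\cdots\prec\mathcal{A}_s$ with each $\mathcal{A}_j$ reduced with respect to $\mathcal{A}_1,\ldots,\mathcal{A}_{j-1}$. An IS product of a chain is a product of initials and separants of its elements. For a differential polynomial $f$ and a chain $\mathcal{AS}$, the Ritt–Wu pseudo-reduction (successive elimination from $f$ of all derivatives obtainable by differentiating the leading derivatives of elements of $\mathcal{AS}$) gives $\mathrm{IS}\cdot f=\sum_{g_i\in\mathcal{AS}}\mathfrak{D}_ig_i+r$, where $\mathrm{IS}$ is an IS product of $\mathcal{AS}$, the $\mathfrak{D}_i$ are linear differential operators with differential polynomial coefficients, and the pseudo-remainder $r=\mathrm{Prem}(f/\mathcal{AS})$ is reduced with respect to $\mathcal{AS}$. For a set $S$, $\mathrm{Prem}(S/\mathcal{AS})=\{\mathrm{Prem}(f/\mathcal{AS}): f\in S\}$. **The chains $C'$, $\mathcal{D}''$, $C$.** Fix a rank $\prec$ on $\mathcal{K}_{\mathbf{z}}[\Lambda']$ with $\xi_1'$ highest among the indeterminates. $C'\subset \mathcal{K}_{\mathbf{z}}[\Lambda']$ is an ascending chain form of $\mathcal{D}'$ obtained by Wu's algorithm under this rank; its elements are linear. Standing assumption: the initials of the elements of $C'$ are not zero, $\mathrm{IS}(C')\not\equiv0$;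 under this assumption $\mathrm{Z}(C')=\mathrm{Z}(\mathcal{D}')$. $\mathcal{D}''\subset C'$ is the subset of those differential polynomials whose leading derivatives are derivatives of $\xi_1'$ with respect to $\mathbf{z}$. Substituting $\xi_i'=\xi_1'\xi_i$ $(i=2,\ldots,p)$, $\eta'=\xi_1'\eta$ turns $C'$ and $\mathcal{D}''$ into systems in $\mathcal{K}_{\mathbf{z}}[\Lambda,\xi_1']$, denoted by the same letters. The rank $\prec$ induces a rank on $\mathcal{K}_{\mathbf{z}}[\Lambda,\xi_1']$ by letting $\xi_i$ take the place of $\xi_i'$ and $\eta$ that of $\eta'$, with $\xi_1'$ still highest. Under the induced rank, $$C=\mathrm{Prem}\big((C'\setminus\mathcal{D}'')/\mathcal{D}''\big)\subset\mathcal{K}_{\mathbf{z}}[\Lambda,\xi_1'].$$ *)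

(* Defs.v *)
From mathcomp Require Import all_boot all_order all_algebra.
From mathcomp Require Export finmap.
From mathcomp.multinomials Require Export monalg.

Set Implicit Arguments.
Unset Strict Implicit.
Unset Printing Implicit Defensive.

Import GRing.Theory.
Local Open Scope ring_scope.

(* Polynomials over R in an arbitrary, possibly infinite, choiceType T of
   indeterminates; [<< m >>] is the monomial m. *)
Notation poly_in T R := {malg R[{cmonom T}]}.

Section Polynomials.
Variable T : choiceType.

Definition pvar (R : comNzRingType) (t : T) : poly_in T R := << ucm t >>.

Definition peval (R S : comNzRingType) (f : R -> S) (a : T -> S)
    (P : poly_in T R) : S :=
  mmap f (fun m : {cmonom T} => \prod_(t <- finsupp m) a t ^+ m t) P.

Variable R : comNzRingType.
Implicit Types (P : poly_in T R) (t : T).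

Definition pvars P : {fset T} := (\bigcup_(m <- msupp P) finsupp m)%fset.

Definition pdeg t P : nat := \max_(m <- msupp P) m t.

Definition pderiv t P : poly_in T R :=
  \sum_(m <- msupp P) << P@_m *+ m t *g divcm m (ucm t) >>.

(* The coefficient of the highest power of t in P. *)
Definition pinit t P : poly_in T R :=
  \sum_(m <- msupp P | m t == pdeg t P)
     << P@_m *g divcm m (expcmn (ucm t) (m t)) >>.

(* The derivation that restricts to d on the coefficients and sends the
   indeterminate t to v t. *)
Definition pderivation (d : R -> poly_in T R) (v : T -> poly_in T R) P
    : poly_in T R :=
  \sum_(m <- msupp P) d P@_m * << m >> + \sum_(t <- pvars P) v t * pderiv t P.

End Polynomials.

(* A multi-index theta : {cmonom 'I_n} stands for the operator
   prod_i d_i ^ theta_i; products of monomials are sums of multi-indices. *)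
Definition diter n (V : Type) (d : 'I_n -> V -> V) (theta : {cmonom 'I_n})
    (x : V) : V :=
  foldr (fun i y => iter (theta i) (d i) y) x (enum 'I_n).

Record diffField (n : nat) := DiffField {
  dfield :> fieldType;
  der : 'I_n -> dfield -> dfield;
  derD : forall i, {morph der i : a b / a + b};
  derM : forall i a b, der i (a * b) = der i a * b + a * der i b;
  derC : forall i j a, der i (der j a) = der j (der i a)
}.

Record diffExt n (K : diffField n) := DiffExt {
  ext :> diffField n;
  emb : {rmorphism K -> ext};
  emb_der : forall i a, emb (der i a) = der i (emb a)
}.

(* The components of z = (x_1, ..., x_p, u) are indexed by 'I_p.+1: x_1 is
   ord0 (p > 0) and u is ord_max. The same index set serves for
   Lambda' = (xi_1', ..., xi_p', eta'). *)
Definition xidx p (i : 'I_p) : 'I_p.+1 := widen_ord (leqnSn p) i.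

Definition coordinates n (K : diffField n) (z : 'I_n -> K) : Prop :=
  forall i j, der i (z j) = (i == j)%:R.

Section DifferentialPolynomials.
Variable n : nat.

(* The derivative d^theta y_i of the i-th differential indeterminate is the
   pair (i, theta). *)
Notation dvar := ('I_n * {cmonom 'I_n})%type.

Variable K : diffField n.

Definition dpoly := poly_in dvar K.

Implicit Types (f g r s : dpoly) (v w : dvar) (A B : seq dpoly).

Definition dvar_der (j : 'I_n) v : dvar := (v.1, mmul v.2 (ucm j)).

Definition dvar_indet (i : 'I_n) : dvar := (i, mone).

Definition dindet (i : 'I_n) : dpoly := pvar K (dvar_indet i).

Definition dp_der (j : 'I_n) : dpoly -> dpoly :=
  pderivation (fun c : K => (der j c)%:MP) (fun v => pvar K (dvar_der j v)).

Definition dp_eval (L : diffExt K) (Y : 'I_n -> L) f : L :=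
  peval (emb L) (fun v => diter (@der n L) v.2 (Y v.1)) f.

Definition is_zero A (L : diffExt K) (Y : 'I_n -> L) : Prop :=
  forall f, f \in A -> dp_eval Y f = 0.

Definition dp_subst (Y : 'I_n -> dpoly) f : dpoly :=
  peval (fun c : K => c%:MP) (fun v => diter dp_der v.2 (Y v.1)) f.

Definition dp_linear f : bool := all (fun m => mdeg m <= 1)%N (msupp f).

Definition dp_homlinear f : bool := all (fun m => mdeg m == 1)%N (msupp f).

Definition linop := seq (dpoly * {cmonom 'I_n}).

Definition linop_apply (D : linop) f : dpoly :=
  \sum_(t <- D) t.1 * diter dp_der t.2 f.

Definition in_diff_ideal A f : Prop :=
  exists D : dpoly -> linop, f = \sum_(g <- A) linop_apply (D g) g.

(* rk v w reads "v is lower than or equal to w". *)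
Definition ranking (rk : rel dvar) : Prop :=
  [/\ total rk, antisymmetric rk, transitive rk,
      forall j v, rk v (dvar_der j v)
    & forall j v w, rk v w -> rk (dvar_der j v) (dvar_der j w)].

Definition highest_indet (rk : rel dvar) (i : 'I_n) : Prop :=
  forall j, rk (dvar_indet j) (dvar_indet i).

Variable rk : rel dvar.

(* For a ranking: None exactly when f lies in K. *)
Definition leader f : option dvar :=
  ohead [seq v <- pvars f | all (rk^~ v) (pvars f)].

Definition rank_lt f g : bool :=
  match leader f, leader g with
  | Some v, Some w =>
      if v == w then (pdeg v f < pdeg v g)%N else rk v w
  | None, Some _ => true
  | _, None => false
  end.

Definition proper_derivative w v : bool :=
  [&& w.1 == v.1, w.2 != v.2 & [forall i, (v.2 i <= w.2 i)%N]].

(* A nonzero element of K reduces everything to 0. *)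
Definition reduced r g : bool :=
  if leader g is Some v then
    all (fun w => ~~ proper_derivative w v) (pvars r)
      && (pdeg v r < pdeg v g)%N
  else r == 0.

Definition ascending_chain A : bool :=
  (0 \notin A) && pairwise (fun f g => rank_lt f g && reduced g f) A.

Definition is_IS A s : Prop :=
  exists g v, [/\ g \in A, leader g = Some v
                & s = pinit v g \/ s = pderiv v g].

Definition is_IS_product A s : Prop :=
  exists2 hs : seq dpoly, forall h, h \in hs -> is_IS A h
                        & s = \prod_(h <- hs) h.

(* r is a pseudo-remainder of f; it depends on the order in which derivatives
   are eliminated, so Prem is a relation. *)
Definition is_prem f A r : Prop :=
  (exists s (D : dpoly -> linop),
     is_IS_product A s
     /\ s * f = \sum_(g <- A) linop_apply (D g) g + r)
  /\ all (reduced r) A.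

Definition is_Prem_set B A (R : seq dpoly) : Prop :=
  (forall r, r \in R -> exists2 f, f \in B & is_prem f A r)
  /\ (forall f, f \in B -> exists2 r, r \in R & is_prem f A r).

(* Output specification of Wu's algorithm. *)
Definition ascending_chain_form A B : Prop :=
  [/\ ascending_chain B,
      forall f, f \in B -> in_diff_ideal A f
    & forall f, f \in A -> is_prem f B 0].

End DifferentialPolynomials.

Notation dvar n := ('I_n * {cmonom 'I_n})%type.

Section Symmetries.
Variables (p : nat) (K : diffField p.+1).

(* F(x, d^k u): inl i is the variable x_i, inr alpha the jet variable
   u_alpha (inr mone being u). *)
Definition jetpoly := poly_in ('I_p + {cmonom 'I_p})%type K.

Definition constant_coeffs (F : jetpoly) : Prop :=
  forall m i, der i F@_m = 0.

Definition has_order (F : jetpoly) (k : nat) : Prop :=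
  (exists2 alpha : {cmonom 'I_p}, inr alpha \in pvars F & mdeg alpha = k)
  /\ (forall alpha : {cmonom 'I_p}, inr alpha \in pvars F -> (mdeg alpha <= k)%N).

Variables (z : 'I_p.+1 -> K) (F : jetpoly) (L : diffExt K).

(* Functions on jet space that are polynomial in the u_alpha, |alpha| > 0;
   the dependence on (x, u) is carried by the coefficients. The indeterminate
   indexed by mone is never used: u is the element z ord_max of K. *)
Definition jetring := poly_in {cmonom 'I_p} L.

Definition ujet (alpha : {cmonom 'I_p}) : jetring := pvar L alpha.

Definition jet_of : jetpoly -> jetring :=
  peval (fun c : K => (emb L c)%:MP)
    (fun t => match t with
      | inl i => (emb L (z (xidx i)))%:MP
      | inr alpha =>
          if alpha == mone then (emb L (z ord_max))%:MP else ujet alpha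
      end).

Definition total_der (i : 'I_p) : jetring -> jetring :=
  pderivation
    (fun c : L => (der (xidx i) c)%:MP + (der ord_max c)%:MP * ujet (ucm i))
    (fun alpha => ujet (mmul alpha (ucm i))).

Variable X : 'I_p.+1 -> L.

Definition characteristic : jetring :=
  (X ord_max)%:MP - \sum_(i < p) (X (xidx i))%:MP * ujet (ucm i).

Definition prolong_coeff (alpha : {cmonom 'I_p}) : jetring :=
  diter total_der alpha characteristic
  + \sum_(i < p) (X (xidx i))%:MP * ujet (mmul alpha (ucm i)).

Definition prolongation : jetring :=
  \sum_(t <- pvars F)
    match t with
    | inl i => (X (xidx i))%:MP
    | inr alpha => prolong_coeff alpha
    end * jet_of (pderiv t F).

(* "Whenever F = 0" quantifies over all values, in all field extensions, of
   the u_alpha with |alpha| > 0, at the generic point z. *)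
Definition classical_symmetry : Prop :=
  forall (M : fieldType) (h : {rmorphism L -> M}) (a : {cmonom 'I_p} -> M),
    peval h a (jet_of F) = 0 -> peval h a prolongation = 0.

End Symmetries.

Definition determining_system p (K : diffField p.+1) (z : 'I_p.+1 -> K)
    (F : jetpoly K) (D' : seq (dpoly K)) : Prop :=
  all (@dp_homlinear p.+1 K) D'
  /\ forall (L : diffExt K) (X : 'I_p.+1 -> L),
       classical_symmetry z F X <-> is_zero D' X.

Section NonclassicalSubstitution.
Variables (p : nat) (K : diffField p.+1).

(* K[Lambda, xi_1'] is again the ring dpoly K, with index ord0 for xi_1' and
   every other index for the component of Lambda that replaces that of
   Lambda'; the induced rank is then the same relation rk. *)
Definition to_Lambda : dpoly K -> dpoly K :=
  dp_subst (fun i => if i == ord0 then dindet K ord0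
                     else dindet K ord0 * dindet K i).

Variable rk : rel (dvar p.+1).

Definition leads_with_xi1 (f : dpoly K) : bool :=
  if leader rk f is Some v then v.1 == ord0 else false.

Definition D'' (C' : seq (dpoly K)) := [seq f <- C' | leads_with_xi1 f].

Definition C'_minus_D'' (C' : seq (dpoly K)) :=
  [seq f <- C' | ~~ leads_with_xi1 f].

(* The point (Lambda, xi_1') of an operator with xi_1' <> 0. *)
Definition normalized (L : diffExt K) (X : 'I_p.+1 -> L) : 'I_p.+1 -> L :=
  fun i => if i == ord0 then X ord0 else X i / X ord0.

End NonclassicalSubstitution.

(* Main.v *)
From HB Require Import structures.
Require Import Defs.
From mathcomp Require Import all_boot all_order all_algebra.
Set Implicit Arguments.
Unset Strict Implicit.
Unset Printing Implicit Defensive.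
Import GRing.Theory.
Local Open Scope ring_scope.

(** A point of $K[\Lambda']$ with $\xi_1' \neq 0$ and its normalization
    $\Lambda = \Lambda'/\xi_1'$ are exchanged by the substitution
    $\xi_i' = \xi_1' \xi_i$: since evaluation at a point is a ring morphism
    that commutes with the derivations ([dp_eval_der]), evaluating a
    substituted polynomial at $(\Lambda, \xi_1')$ is evaluating the original
    one at $\Lambda'$ ([dp_eval_subst], [dp_eval_to_Lambda]). Hence both the
    divisors $D''$ and the dividends $C' \setminus D''$ vanish at
    $(\Lambda, \xi_1')$ as soon as $C'$ vanishes at $\Lambda'$.

    Evaluating the pseudo-reduction identity
    $\mathrm{IS} \cdot f = \sum_i \mathfrak{D}_i g_i + r$ at that point kills
    $f$, every $g_i$ and hence every $\mathfrak{D}_i g_i$; the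
    pseudo-remainder $r$ is what is left, so it vanishes too
    ([dp_eval_prem]).

    For classical symmetries, the determining system vanishes at $\Lambda'$,
    and $C'$ lies in the differential ideal that the system generates, so
    that $C'$ vanishes there too. *)

(** * Values of monomials and derivations *)

Section MonomialValue.
Variables (T : choiceType) (S : comNzRingType) (a : T -> S).
Implicit Types m : {cmonom T}.

Definition mvalue m : S := \prod_(t <- finsupp m) a t ^+ m t.

(** Monomials with different supports are compared by writing their values
    over a common range. *)
Lemma mvalueEw (d : {fset T}) m :
  (finsupp m `<=` d)%fset -> mvalue m = \prod_(t <- d) a t ^+ m t.
Proof.
move=> le_md; rewrite /mvalue (big_fset_incl _ le_md) //= => t _.
by rewrite -cmE_eq0 => /eqP ->; rewrite expr0.
Qed.

Lemma mvalue_morphism : mmorphism mvalue.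
Proof.
split=> [m1 m2|]; last by rewrite /mvalue mdom1 big_seq_fset0.
rewrite (mvalueEw (fsubsetUl (finsupp m1) (finsupp m2))).
rewrite (mvalueEw (fsubsetUr (finsupp m1) (finsupp m2))).
rewrite /mvalue mdomD -big_split; apply: eq_bigr => t _.
by rewrite cmM exprD.
Qed.

HB.instance Definition _ :=
  monalg.isMultiplicative.Build {cmonom T} S mvalue mvalue_morphism.

Lemma mvalueU t : mvalue (ucm t) = a t.
Proof. by rewrite /mvalue mdomU big_seq_fset1 cmUU expr1. Qed.

Lemma mvalue_div m t : t \in finsupp m ->
  mvalue (divcm m (ucm t)) =
  a t ^+ (m t).-1 * \prod_(u <- finsupp m | u != t) a u ^+ m u.
Proof.
move=> tm; have le_div : (finsupp (divcm m (ucm t)) `<=` finsupp m)%fset.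
  apply/fsubsetP => u; rewrite -!cmE_neq0 divcmE.
  by apply: contra => /eqP ->.
rewrite (mvalueEw le_div) (bigD1_seq t) ?fset_uniq //= divcmE ucmE eqxx subn1.
congr (_ * _); apply: eq_bigr => u; rewrite divcmE ucmE eq_sym => /negPf ->.
by rewrite subn0.
Qed.

End MonomialValue.

Section Derivation.
Variables (S : comNzRingType) (D : S -> S).
Hypothesis DD : {morph D : a b / a + b}.
Hypothesis DM : forall a b, D (a * b) = D a * b + a * D b.

Lemma derivation0 : D 0 = 0.
Proof. by apply: (addrI (D 0)); rewrite -DD !addr0. Qed.

Lemma derivation1 : D 1 = 0.
Proof.
by have := DM 1 1; rewrite !mulr1 mul1r -[LHS]addr0 => /addrI.
Qed.

Lemma derivation_sum (I : Type) (r : seq I) (E : I -> S) :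
  D (\sum_(i <- r) E i) = \sum_(i <- r) D (E i).
Proof. exact: (big_morph D DD derivation0). Qed.

Lemma derivation_exp x k : D (x ^+ k) = D x * x ^+ k.-1 *+ k.
Proof.
elim: k => [|k IHk]; first by rewrite expr0 derivation1 mulr0n.
rewrite exprS DM IHk mulrnAr mulrCA mulrS /=; congr (_ + _).
by case: k {IHk} => [|k]; rewrite ?mulr0n // -exprS.
Qed.

Lemma derivation_prod (I : eqType) (r : seq I) (E : I -> S) : uniq r ->
  D (\prod_(i <- r) E i) =
  \sum_(i <- r) D (E i) * \prod_(j <- r | j != i) E j.
Proof.
elim: r => [|i r IHr] /=; first by rewrite !big_nil derivation1.
case/andP=> ir ur; rewrite !big_cons DM IHr // eqxx /=; congr (_ + _).
  congr (_ * _); rewrite big_seq [RHS]big_seq_cond; apply: eq_bigl => j.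
  by case: eqVneq => [->|_]; rewrite ?(negPf ir) ?andbF ?andbT.
rewrite mulr_sumr; apply: eq_big_seq => j jr.
have ij : i != j by apply: contraNneq ir => ->.
by rewrite big_cons ij mulrCA.
Qed.

Variables (T : choiceType) (a : T -> S).

(** The chain rule, in the shape of [pderiv]: the partial derivative of [m] in
    [t] is the quotient of [m] by [t] taken [m t] times. *)
Lemma derivation_mvalue (m : {cmonom T}) :
  D (mvalue a m) =
  \sum_(t <- finsupp m) D (a t) * (mvalue a (divcm m (ucm t)) *+ m t).
Proof.
rewrite derivation_prod ?fset_uniq //; apply: eq_big_seq => t tm.
by rewrite derivation_exp mvalue_div // mulrnAl mulrnAr mulrA.
Qed.

End Derivation.

(** * Evaluation of polynomials *)

Section Evaluation.
Variables (T : choiceType) (R S : comNzRingType).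
Variables (f : {rmorphism R -> S}) (a : T -> S).

Lemma pevalE P : peval f a P = mmap f (mvalue a) P.
Proof. by []. Qed.

Lemma pevalC c : peval f a c%:MP = f c.
Proof. by rewrite pevalE mmapC. Qed.

Lemma peval_pvar t : peval f a (pvar R t) = a t.
Proof. by rewrite pevalE mmapU /= rmorph1 mul1r mvalueU. Qed.

(** The derivations [pderivation d v] and [D] correspond under evaluation as
    soon as they do so on coefficients and on indeterminates. Each monomial
    has its own support; all the sums over indeterminates are brought to the
    common range [pvars P], where the extra terms carry a zero exponent. *)
Lemma peval_derivation (D : S -> S) (DD : {morph D : x y / x + y})
    (DM : forall x y, D (x * y) = D x * y + x * D y)
    (d : R -> poly_in T R) (v : T -> poly_in T R) :
    (forall c, peval f a (d c) = D (f c)) ->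
    (forall t, peval f a (v t) = D (a t)) ->
  forall P, peval f a (pderivation d v P) = D (peval f a P).
Proof.
move=> Hd Hv P; rewrite pevalE /pderivation rmorphD !rmorph_sum /=.
rewrite [in RHS]pevalE mmapE (derivation_sum DD).
rewrite [RHS](eq_bigr _ (fun m _ => DM _ _)).
rewrite big_split /=; congr (_ + _).
  apply: eq_bigr => m _.
  by rewrite rmorphM /= -pevalE Hd mmapU /= rmorph1 mul1r.
transitivity (\sum_(t <- pvars P) \sum_(m <- msupp P)
    f P@_m * (D (a t) * (mvalue a (divcm m (ucm t)) *+ m t))).
  apply: eq_bigr => t _.
  rewrite rmorphM /= -pevalE Hv /pderiv raddf_sum mulr_sumr /=.
  apply: eq_bigr => m _.
  by rewrite mmapU /= rmorphMn /= mulrnAl -mulrnAr mulrCA.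
rewrite exchange_big; apply: eq_big_seq => m mP.
rewrite -mulr_sumr (derivation_mvalue DM); congr (_ * _).
apply/esym/big_fset_incl; first exact: bigfcup_sup mP _.
by move=> t _ /=; rewrite -cmE_eq0 => /eqP ->; rewrite mulr0n mulr0.
Qed.

End Evaluation.

Lemma rmorph_mvalue (T : choiceType) (R S : comNzRingType)
    (phi : {rmorphism R -> S}) (a : T -> R) m :
  phi (mvalue a m) = mvalue (phi \o a) m.
Proof. by rewrite rmorph_prod; apply: eq_bigr => t _; rewrite rmorphXn. Qed.

(** * Iterated derivations *)

Section IteratedDerivation.
Variables (n : nat) (V : Type) (d : 'I_n -> V -> V).

(** Multi-indices act additively: the new factor can be moved outermost
    because the operators commute. *)
Lemma diterU (dC : forall i j x, d i (d j x) = d j (d i x))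
    (theta : {cmonom 'I_n}) j x :
  diter d (mmul theta (ucm j)) x = d j (diter d theta x).
Proof.
have iterC i k y : iter k (d i) (d j y) = d j (iter k (d i) y).
  by elim: k => //= k ->; rewrite dC.
(* The operator d j occurs only once, at the position of j in the list. *)
suff foldE s : uniq s ->
    foldr (fun i y => iter (mmul theta (ucm j) i) (d i) y) x s =
    let y := foldr (fun i y => iter (theta i) (d i) y) x s in
    if j \in s then d j y else y.
  by rewrite /diter foldE ?enum_uniq //= mem_enum.
elim: s => //= i s IHs /andP[i_s /IHs ->] /=; rewrite in_cons cmM cmU.
have [->|_] /= := eqVneq j i; last by rewrite addn0; case: ifP; rewrite ?iterC.
by rewrite (negPf i_s) addn1.
Qed.

Lemma diter_morph (W : Type) (d' : 'I_n -> W -> W) (phi : V -> W) :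
    (forall i x, phi (d i x) = d' i (phi x)) ->
  forall theta x, phi (diter d theta x) = diter d' theta (phi x).
Proof.
move=> phiE theta x; rewrite /diter; elim: (enum _) => //= i s <-.
by elim: (theta i) => //= k <-.
Qed.

End IteratedDerivation.

(** * Evaluation and substitution of differential polynomials *)

Section DifferentialEvaluation.
Variables (n : nat) (K : diffField n) (L : diffExt K).
Implicit Types (Y : 'I_n -> L) (f g r : dpoly K) (A : seq (dpoly K)).

(* Evaluation of polynomials is a ring morphism; the instance carries this over
   to [dp_eval], which is opaque to inference. *)
HB.instance Definition _ Y := GRing.RMorphism.copy (dp_eval Y)
  (mmap (emb L) (mvalue (fun v : dvar n => diter (@der n L) v.2 (Y v.1)))).

(** At the indeterminate $\partial^\theta y_i$ this says that
    differentiating $\partial^\theta Y_i$ once more gives the value of the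
    next derivative; this is where commutation of the derivations of [L]
    enters. *)
Lemma dp_eval_der Y j f : dp_eval Y (dp_der j f) = der j (dp_eval Y f).
Proof.
apply: peval_derivation => [||c|v]; [exact: derD | exact: derM | |].
  by rewrite pevalC emb_der.
by rewrite peval_pvar diterU //; exact: derC.
Qed.

Lemma dp_eval_diter Y theta f :
  dp_eval Y (diter (@dp_der n K) theta f) =
  diter (@der n L) theta (dp_eval Y f).
Proof. by apply: diter_morph => j g; exact: dp_eval_der. Qed.

Lemma dp_eval_dindet Y i : dp_eval Y (dindet K i) = Y i.
Proof.
rewrite /dp_eval peval_pvar /= /diter.
by elim: (enum _) => //= j s ->; rewrite cm1.
Qed.

(** Both sides are ring morphisms in [f] that agree on coefficients; on a
    derivative $\partial^\theta y_i$ they agree because evaluation commutes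
    with $\partial^\theta$. *)
Lemma dp_eval_subst Y (W : 'I_n -> dpoly K) f :
  dp_eval Y (dp_subst W f) = dp_eval (fun i => dp_eval Y (W i)) f.
Proof.
rewrite /dp_subst /peval mmapE rmorph_sum; apply: eq_bigr => m _.
rewrite rmorphM /= {1}/dp_eval pevalC; congr (_ * _).
rewrite -/(mvalue _ m) rmorph_mvalue; apply: eq_bigr => v _.
by rewrite /= dp_eval_diter.
Qed.

Lemma diter_der0 theta : diter (@der n L) theta 0 = 0.
Proof.
rewrite /diter; elim: (enum _) => //= i s ->.
by elim: (theta i) => //= k ->; exact/derivation0/derD.
Qed.

Lemma dp_eval_linop_sum Y A (D : dpoly K -> linop K) :
  is_zero A Y -> dp_eval Y (\sum_(g <- A) linop_apply (D g) g) = 0.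
Proof.
move=> A0; rewrite rmorph_sum big_seq big1 //= => g /A0 g0.
rewrite rmorph_sum big1 // => t _.
by rewrite rmorphM /= dp_eval_diter g0 diter_der0 mulr0.
Qed.

Lemma dp_eval_diff_ideal Y A f :
  is_zero A Y -> in_diff_ideal A f -> dp_eval Y f = 0.
Proof. by move=> A0 [D ->]; exact: dp_eval_linop_sum. Qed.

Lemma dp_eval_prem Y rk A f r :
  is_zero A Y -> dp_eval Y f = 0 -> is_prem rk f A r -> dp_eval Y r = 0.
Proof.
move=> A0 f0 [[s [D [_ reduction]]] _].
have /= := congr1 (dp_eval Y) reduction.
by rewrite rmorphM rmorphD /= f0 mulr0 dp_eval_linop_sum // add0r.
Qed.

End DifferentialEvaluation.

(** * Normalization of operators *)

Section Normalization.
Variables (p : nat) (K : diffField p.+1) (L : diffExt K) (X : 'I_p.+1 -> L).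
Hypothesis X0 : X ord0 != 0.

Lemma normalizedE i : i != ord0 -> X i = X ord0 * normalized X i.
Proof. by move=> /negPf i0; rewrite /normalized i0 mulrC divfK. Qed.

Lemma eq_dp_eval (Y : 'I_p.+1 -> L) : X =1 Y -> @dp_eval _ K L X =1 dp_eval Y.
Proof.
move=> XY f; apply: eq_bigr => m _; congr (_ * _).
by apply: eq_bigr => v _; rewrite XY.
Qed.

(** The values at $(\Lambda, \xi_1')$ of the polynomials substituted by
    [to_Lambda] are $\xi_1'$ and the products $\xi_1' \xi_i$, that is, the
    components of $\Lambda'$ itself. *)
Lemma dp_eval_to_Lambda f :
  dp_eval (normalized X) (to_Lambda f) = dp_eval X f.
Proof.
rewrite dp_eval_subst; apply/esym/eq_dp_eval => i /=.
case: eqVneq => [->|i0]; first by rewrite dp_eval_dindet.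
rewrite (rmorphM (dp_eval (normalized X))) (normalizedE i0).
apply: congr2 => /=; last by rewrite dp_eval_dindet.
by rewrite dp_eval_dindet /normalized eqxx.
Qed.

Lemma is_zero_Prem_normalized rk (C' C : seq (dpoly K)) :
    is_Prem_set rk (map (@to_Lambda p K) (C'_minus_D'' rk C'))
                   (map (@to_Lambda p K) (D'' rk C')) C ->
  is_zero C' X -> is_zero C (normalized X).
Proof.
move=> [Crem _] C'0 r /Crem[_ /mapP[f + ->]].
rewrite mem_filter => /andP[_ fC']; apply: dp_eval_prem => [_ /mapP[g + ->]|].
  by rewrite mem_filter dp_eval_to_Lambda => /andP[_ /C'0].
by rewrite dp_eval_to_Lambda C'0.
Qed.

End Normalization.

Theorem theorem3 (p k : nat) (hp : (0 < p)%N) (hk : (0 < k)%N)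
    (K : diffField p.+1) (charK : [pchar K] =i pred0)
    (z : 'I_p.+1 -> K) (hz : coordinates z)
    (F : jetpoly K) (hFc : constant_coeffs F) (hFk : has_order F k)
    (D' : seq (dpoly K)) (hD' : determining_system z F D')
    (rk : rel (dvar p.+1)) (hrk : ranking rk) (hxi1 : highest_indet rk ord0)
    (C' : seq (dpoly K)) (hC' : ascending_chain_form rk D' C')
    (hC'lin : all (@dp_linear p.+1 K) C')
    (hIS : forall s, is_IS_product rk C' s -> s != 0)
    (C : seq (dpoly K))
    (hC : is_Prem_set rk (map (@to_Lambda p K) (C'_minus_D'' rk C'))
                         (map (@to_Lambda p K) (D'' rk C')) C) :
  (forall (L : diffExt K) (X' : 'I_p.+1 -> L),
     classical_symmetry z F X' -> X' ord0 != 0 ->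
     exists Y : 'I_p.+1 -> L,
       [/\ is_zero C Y, Y ord0 = X' ord0
         & forall i, i != ord0 -> X' i = X' ord0 * Y i])
  /\
  (forall (L : diffExt K) (X' : 'I_p.+1 -> L),
     is_zero C' X' -> X' ord0 != 0 -> is_zero C (normalized X')).
Proof.
have zeroC (L : diffExt K) (X' : 'I_p.+1 -> L) :
    is_zero C' X' -> X' ord0 != 0 -> is_zero C (normalized X').
  by move=> C'0 X'0; apply: is_zero_Prem_normalized hC C'0.
split=> // L X' symX' X'0; exists (normalized X'); split=> //; last first.
  by move=> i; exact: normalizedE.
apply: zeroC => // f fC'; case: hC' => _ C'D' _.
exact: dp_eval_diff_ideal ((hD'.2 L X').1 symX') (C'D' f fC').
Qed.
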